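(* Let $p$ be an odd prime, $n>1$, and let $A$ be a commutative nilpotent $\mathbb{F}_p$-algebra of dimension $n$ with $A^3=0$, $\dim_{\mathbb{F}_p}(A^2)=1$ and non-zero structure matrix $\mathrm{diag}(D_s,0)$ of rank $k\ge1$, where $D_s=\mathrm{diag}(1,\dots,1,s)$ is $k\times k$, with $s=1$ if $k$ is odd, and $s=1$ or $s$ a non-square in $\mathbb{F}_p$ if $k$ is even. Let $L/K$ be a Galois extension of fields with Galois group $G\cong(A,+)$ and with the Hopf Galois structure, by a $K$-Hopf algebra $H$, associated to the skew brace $(A,+,\circ)$. Then the Galois correspondence ratio satisfies $$GC(L/K,(A,+),H)=O\!\left(\frac{1}{p^{(n-1)/2}}\right)\ \text{for } n \text{ odd},\qquad GC(L/K,(A,+),H)=O\!\left(\frac{1}{p^{n/2}}\right)\ \text{for } n\text{ even},$$ where the implied constants do not depend on $p$.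
   Context: A nilpotent $\mathbb{F}_p$-algebra is an associative (non-unital) $\mathbb{F}_p$-algebra $A$ with $A^m=0$ for some $m>1$; $A^3=0$ means all products of three elements vanish, and $A^2$ is the span of products of two elements. That $A$ has structure matrix $\Phi=(\phi_{ij})$ means: $A$ has an $\mathbb{F}_p$-basis $(x_1,\dots,x_n)$ with $x_n$ spanning $A^2$ and $x_ix_j=\phi_{ij}x_n$ for all $i,j$. The adjoint operation is $a\circ b=a+b+a\cdot b$, which makes $A$ a group $(A,\circ)$, and $\lambda_\circ(x)(y)=x\circ y$. The Hopf Galois structure on $L/K$ associated to $(A,+,\circ)$ is the one corresponding under Greither--Pareigis to the regular subgroup $T=\lambda_\circ(A)\subset\mathrm{Perm}(A)$, which is normalized by $\lambda_+(A)$ since $A^3=0$; its Hopf algebra is $H=(LT)^G$. The Galois correspondence for this Hopf Galois structure is the map from $K$-sub-Hopf algebras of $H$ to intermediate fields of $L/K$, sending a sub-Hopf algebra to its fixed field. The Galois correspondence ratio $GC(L/K,(A,+),H)$ is the number of intermediate fields in the image of this map divided by the total number of intermediate fields $K\subseteq E\subseteq L$. It is known (Childs) that the image is in bijective correspondence with the ideals of the algebra $A$, so that $$GC(L/K,(A,+),H)=\frac{|\{\text{ideals of }A\}|}{|\{\text{subgroups of }(A,+)\}|}.$$ *)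

(* Defs.v *)
From mathcomp Require Import all_boot all_order all_fingroup all_algebra all_field.
From mathcomp Require Import finmap boolp classical_sets cardinality.

Set Implicit Arguments.
Unset Strict Implicit.
Unset Printing Implicit Defensive.

Import GRing.Theory.
Local Open Scope ring_scope.

(* Non-unital algebras: an F-vector space V with a bilinear product mul
   (associativity is a separate hypothesis). *)
Section NonUnitalAlgebra.

Variables (F : fieldType) (V : vectType F).
Implicit Types mul : {bilinear V -> V -> V}.

(* By bilinearity, products of basis vectors span all products
   (same device as prodv in the library). *)
Definition prod_space mul (U W : {vspace V}) : {vspace V} :=
  <<[seq mul u w | u <- vbasis U, w <- vbasis W]>>%VS.

(* power_space mul m is V^m for m > 0; the value at m = 0 is irrelevant. *)
Definition power_space mul (m : nat) : {vspace V} :=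
  iter m.-1 (fun U => prod_space mul U fullv) fullv.

Definition nilpotent_alg mul : Prop :=
  exists2 m, (1 < m)%N & power_space mul m = 0%VS.

Definition has_structure_matrix mul n (Phi : 'M[F]_n) : Prop :=
  exists x : n.-tuple V,
    [/\ basis_of fullv x,
        <[x`_n.-1]>%VS = power_space mul 2 &
        forall i j : 'I_n, mul x`_i x`_j = Phi i j *: x`_n.-1].

Definition circle mul (x y : V) : V := x + y + mul x y.

End NonUnitalAlgebra.

(* The n x n matrix diag(D_s, 0), with D_s = diag(1, ..., 1, s) of size k. *)
Definition diagDs (F : fieldType) (n k : nat) (s : F) : 'M[F]_n :=
  \matrix_(i, j) (if (i == j) && (i < k)%N
                  then (if i == k.-1 :> nat then s else 1) else 0).

(* Hopf Galois structures after Greither and Pareigis.  L is a finite normal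
   extension of K; gal_of {:L}, abbreviated G, is the group of all
   K-automorphisms of L.  In the library products in G and in {perm G} are
   composed left to right: (g * h) x = h (g x), so the composite "first v, then
   u" is v * u. *)
Section HopfGalois.

Variables (K : fieldType) (L : splittingFieldType K).
Local Notation G := (gal_of (fullv : {vspace L})).

(* left_transl_perm g is h |-> g \o h. *)
Definition left_transl_perm (g : G) : {perm G} := perm (@mulIg _ g).

(* The group algebra L[Perm(G)]; for N inside Perm(G), LN is the subspace of
   elements supported in N.  The K-space structure is pointwise. *)
Definition perm_alg := {ffun {perm G} -> L}.

Definition pa_one : perm_alg := [ffun t => (t == 1%g)%:R].
Definition pa_mul (a b : perm_alg) : perm_alg :=
  [ffun t => \sum_(uv : {perm G} * {perm G} | (uv.2 * uv.1)%g == t)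
               a uv.1 * b uv.2].
Definition pa_counit (a : perm_alg) : L := \sum_t a t.
Definition pa_antipode (a : perm_alg) : perm_alg := [ffun t => a (t^-1)%g].

(* LN tensored over L with itself is identified with functions on pairs. *)
Definition perm_alg2 := {ffun {perm G} * {perm G} -> L}.
Definition pa_comul (a : perm_alg) : perm_alg2 :=
  [ffun st => if st.1 == st.2 then a st.1 else 0].
Definition pure_tensor (a b : perm_alg) : perm_alg2 :=
  [ffun st => a st.1 * b st.2].

(* With l = left_transl_perm g, g acts on L[Perm(G)] by
   g . (\sum_t a_t t) = \sum_t g(a_t) (l \o t \o l^-1). *)
Definition pa_gal_act (g : G) (a : perm_alg) : perm_alg :=
  [ffun t => g (a (t ^ (left_transl_perm g)^-1)%g)].

(* H = (LN)^G; it is a K-Hopf algebra when N is a regular subgroup of Perm(G)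
   normalized by the left translations. *)
Definition in_hopf (N : {set {perm G}}) (a : perm_alg) : Prop :=
  (forall t, t \notin N -> a t = 0) /\ (forall g : G, pa_gal_act g a = a).

(* The Greither-Pareigis action of H on L:
   (\sum_t a_t t) . x = \sum_t a_t (t^-1(1_G))(x). *)
Definition hopf_act (a : perm_alg) (x : L) : L :=
  \sum_(t : {perm G}) a t * ((t^-1)%g 1%g : G) x.

(* The image of W (x)_K W in LN (x)_L LN.  For W inside H the map from W (x)_K W
   is injective, as L (x)_K H = LN by Galois descent. *)
Definition tensor_square (W : {vspace perm_alg}) : {vspace perm_alg2} :=
  <<[seq pure_tensor a b | a <- vbasis W, b <- vbasis W]>>%VS.

Definition sub_hopf (N : {set {perm G}}) (W : {vspace perm_alg}) : Prop :=
  [/\ forall a, a \in W -> in_hopf N a,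
      pa_one \in W,
      forall a b, a \in W -> b \in W -> pa_mul a b \in W,
      forall a, a \in W -> pa_antipode a \in W &
      forall a, a \in W -> pa_comul a \in tensor_square W].

Definition is_fixed_field (W : {vspace perm_alg}) (E : {subfield L}) : Prop :=
  forall x, x \in E <-> (forall a, a \in W -> hopf_act a x = pa_counit a * x).

Definition galois_corr_image (N : {set {perm G}}) : set {subfield L} :=
  [set E | exists2 W, sub_hopf N W & is_fixed_field W E]%classic.

(* Cardinals via fset_set are meaningful because the set of intermediate fields
   of a Galois extension is finite, see finite_intermediate below. *)
Definition GC (N : {set {perm G}}) : rat :=
  (#|` fset_set (galois_corr_image N)|)%fset%:R
    / (#|` fset_set [set: {subfield L}]%classic|)%fset%:R.

Lemma finite_intermediate :
  galois 1%AS {:L}%AS -> finite_set [set: {subfield L}]%classic.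
Proof.
move=> galL.
pose h (E : {subfield L}) : {set G} := 'Gal({:L} / E)%g.
have h_inj : injective h.
  move=> E1 E2 eqh; apply: val_inj => /=.
  have galE (E : {subfield L}) : fixedField (h E) = E.
    by apply/galois_fixedField; apply: galoisS galL; rewrite sub1v subvf.
  by rewrite -(galE E1) -(galE E2) eqh.
apply: (@finite_preimage _ _ setT h) => //; first by move=> ? ? _ _; apply: h_inj.
Qed.

(* The translate lambda_o(A) = { y |-> x o y } of a circle operation on A,
   carried from Perm(A) to Perm(G) along f : G -> A. *)
Definition circle_translations (F : fieldType) (A : vectType F)
    (mul : {bilinear A -> A -> A}) (f : G -> A) : {set {perm G}} :=
  [set t : {perm G} | `[< exists x : A, forall g, f (t g) = circle mul x (f g) >]]%SET.

End HopfGalois.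

(* Main.v *)
(* By comultiplication-stability, a sub-Hopf algebra W is spanned over L by the
   permutations in its support, so its fixed field is that of
   Y = { t^-1(1) | t in the support of W }.  Invariance under G means that the
   support is normalized by the left translations; for circle translations this
   reads: y in Y implies y - y z in Y for every z.  Hence the span of Y either
   contains A^2 = <x_n>, or annihilates A and so has zero x_1-coordinate.  In
   both cases it is determined by a subspace of an (n-1)-dimensional space, so
   the image has at most 2 G(n-1) elements, where G(m) counts the subspaces of
   F_p^m.  On the other hand there are at least p^(floor(n/2) ceil(n/2))
   intermediate fields, corresponding to the graphs of the linear maps
   F_p^floor(n/2) -> F_p^ceil(n/2), while G(m) = O(p^(floor(m/2) ceil(m/2))). *)
Require Import Defs.
From mathcomp Require Import finmap boolp classical_sets cardinality.
From mathcomp Require Import all_boot all_order all_fingroup all_algebra all_field.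
From HB Require Import structures.
From mathcomp Require Import zify.

Set Implicit Arguments.
Unset Strict Implicit.
Unset Printing Implicit Defensive.

Import GRing.Theory Num.Theory.
Local Open Scope ring_scope.

(** * Counting subspaces of a finite vector space *)

Lemma mul_subn_leq_half N r :
  (r <= N)%N -> (r * (N - r) <= N./2 * uphalf N)%N.
Proof.
rewrite uphalf_half; set a := N./2; set b := nat_of_bool (odd N).
have defN : (N = a + (b + a))%N by rewrite addnCA addnn odd_double_half.
have b_le1 : (b <= 1)%N := leq_b1 _.
rewrite {}defN; move: a b b_le1 => a b b_le1 le_r.
(* For r = a - u the product is a(a + b) - u(u + b). *)
have [/subnK | lt_ar] := leqP r a; first by move: (_ - _)%N => u; nia.
have [t eq_t] : {t | (a + (b + a) = r + t)%N}.
  by exists (a + (b + a) - r)%N; rewrite subnKC.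
have [u def_r] : {u | r = (a + u.+1)%N}.
  by exists (r - a.+1)%N; rewrite addnS -addSn subnKC.
have {}eq_t : (b + a = u.+1 + t)%N by lia.
have le_ta : (t <= a)%N by lia.
have -> : (a + (b + a) - r = t)%N by lia.
rewrite eq_t def_r !(mulnDl, mulnDr) addnC leq_add2r mulnC.
by rewrite leq_mul2r le_ta orbT.
Qed.

Section SubspaceCount.

Variable F : finFieldType.
Implicit Types N r : nat.

(* Subspaces of F^N, represented by their canonical generating matrices. *)
Definition row_spaces N : {set 'M[F]_N} := [set D | <<D>>%MS == D].

Lemma row_spaces_inj N (D D' : 'M[F]_N) :
  D \in row_spaces N -> D' \in row_spaces N -> (D :=: D')%MS -> D = D'.
Proof.
by rewrite !inE => /eqP DE /eqP DE' eqDD'; rewrite -DE -DE'; apply: eq_genmx.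
Qed.

(** The order of GL is a power of q times a product of factors q^i - 1 with i > 0, and q >= 2 gives
    q^i <= 2(q^i - 1). The loss is thus a power of 2, independent of q. *)
Lemma card_GL_lower r :
  (#|F| ^ (r.+1 * r.+1) <= 2 ^ r.+1 * #|'GL_r.+1[F]%g|)%N.
Proof.
rewrite card_GL //; set q := #|F|.
have q_gt1 : (1 < q)%N by exact: finNzRing_gt1.
have expq i : (q ^ i.+1 <= 2 * (q ^ i.+1 - 1))%N.
  have : (0 < q ^ i)%N by rewrite expn_gt0 ltnW.
  by rewrite expnS; nia.
have {expq} prodq n :
    (q ^ 'C(n.+1, 2) <= 2 ^ n * \prod_(1 <= i < n.+1) (q ^ i - 1))%N.
  elim: n => [|n IHn]; first by rewrite big_nil.
  rewrite big_nat_recr //= binS bin1 expnD (expnS 2).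
  by have := leq_mul IHn (expq n); nia.
have <- : ('C(r.+1, 2) + 'C(r.+2, 2) = r.+1 * r.+1)%N.
  elim: r => // r IHr.
  by move: IHr; rewrite (binS r.+2) bin1 (binS r.+1 1) bin1; lia.
by rewrite expnD mulnCA leq_mul2l prodq orbT.
Qed.

(* The pairs (D, P) with D of rank r and P in GL_r embed into the r x N matrices
   via the product of P with a chosen basis of D. *)
Lemma card_row_spaces_rank N r : (r <= N)%N ->
  (#|[set D in row_spaces N | \rank D == r]| <= 2 ^ r * #|F| ^ (r * (N - r)))%N.
Proof.
move=> le_rN; case: r le_rN => [_|r le_rN].
  rewrite mul0n !expn0 muln1 -(cards1 (0 : 'M[F]_N)).
  apply/subset_leq_card/subsetP.
  by move=> D; rewrite !inE mxrank_eq0 => /andP[].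
set S := [set D in _ | _].
pose base (D : 'M[F]_N) : 'M_(r.+1, N) :=
  odflt 0 [pick B : 'M_(r.+1, N) | row_free B && (B == D)%MS].
have baseP D : D \in S -> row_free (base D) /\ (base D :=: D)%MS.
  rewrite inE => /andP[_ /eqP rkD]; rewrite /base.
  case: pickP => [B /andP[freeB /eqmxP] //| noB].
  suff [B fB eqB] : exists2 B : 'M_(r.+1, N), row_free B & (B :=: D)%MS.
    by have /negP[] := noB B; rewrite fB; apply/eqmxP.
  move: (row_base D) (row_base_free D) (eq_row_base D); rewrite rkD => B.
  by exists B.
pose comb (u : 'M[F]_N * {'GL_r.+1[F]}) : 'M[F]_(r.+1, N) :=
  GLval u.2 *m base u.1.
(* Left multiplication by an invertible matrix keeps the row space, which recovers D; row-freeness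
   of [base D] then recovers P. *)
have comb_inj : {in setX S [set: {'GL_r.+1[F]}] &, injective comb}.
  move=> [D P] [D' P']; rewrite !in_setX !in_setT !andbT /= => SD SD' eq_comb.
  have combE E (Q : {'GL_r.+1[F]}) : E \in S -> (comb (E, Q) :=: E)%MS.
    move=> /baseP[_]; apply: eqmx_trans.
    by apply: eqmxMfull; rewrite row_full_unit; apply: (valP Q).
  have eqDD' : D = D'.
    have [SD1 SD1'] : D \in row_spaces N /\ D' \in row_spaces N.
      by move: SD SD'; rewrite 2!inE => /andP[-> _]; rewrite inE => /andP[].
    apply: row_spaces_inj => //; apply: (eqmx_trans (eqmx_sym (combE D P SD))).
    by rewrite eq_comb; apply: combE.
  rewrite -{D'}eqDD' in SD' eq_comb *; congr (_, _); apply: val_inj.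
  by have [freeB _] := baseP D SD; apply: (row_free_inj freeB eq_comb).
have := max_card [in comb @: setX S [set: {'GL_r.+1[F]}]].
rewrite (card_in_imset comb_inj) cardsX card_mx => bound.
(* Multiplying the goal by this power turns the exponent on the right into that of the number of all
   matrices with r + 1 rows and N columns, as in [bound]. *)
have q_gt0 : (0 < #|F| ^ (r.+1 * r.+1))%N.
  by rewrite expn_gt0 ltnW // finNzRing_gt1.
rewrite -(leq_pmul2r q_gt0) -mulnA -expnD -mulnDr subnK //.
apply: leq_trans (leq_mul (leqnn _) (card_GL_lower r)) _.
by rewrite mulnCA leq_mul2l bound orbT.
Qed.

Lemma card_row_spaces N :
  (#|row_spaces N| <= N.+1 * 2 ^ N * #|F| ^ (N./2 * uphalf N))%N.
Proof.
have -> : row_spaces N =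
    \bigcup_(r < N.+1) [set D in row_spaces N | \rank D == r].
  apply/setP=> D; apply/idP/bigcupP => [SD | [r _]]; last first.
    by rewrite inE => /andP[].
  have rkD : (\rank D < N.+1)%N by rewrite ltnS rank_leq_row.
  by exists (Ordinal rkD); rewrite // inE SD /=.
have leq_bigcup (T : finType) n (B : 'I_n -> {set T}) :
    (#|\bigcup_i B i| <= \sum_i #|B i|)%N.
  elim/big_rec2: _ => [|i b C _ leCb]; first by rewrite cards0.
  by rewrite (leq_trans (leq_card_setU _ _)) // leq_add2l.
apply: leq_trans (leq_bigcup _ _ _) _.
rewrite -mulnA -[X in (_ <= X * _)%N](card_ord N.+1) -sum_nat_const.
apply: leq_sum => r _.
have le_rN : (r <= N)%N by rewrite -ltnS.
apply: leq_trans (card_row_spaces_rank le_rN) _.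
apply: leq_mul; first by rewrite leq_exp2l.
rewrite leq_exp2l ?finNzRing_gt1 //.
exact: mul_subn_leq_half.
Qed.

End SubspaceCount.

(** * Subspaces under deletion of one coordinate *)

Section DeletedColumn.

Variables (F : fieldType) (n m : nat) (M : 'M[F]_(n, m.+1)) (j : 'I_m.+1).

Lemma mul_col' (w : 'rV[F]_n) : col' j (w *m M) = w *m col' j M.
Proof.
by apply/rowP=> i; rewrite !mxE; apply: eq_bigr => k _; rewrite !mxE.
Qed.

Lemma col'_eq0 (v : 'rV[F]_m.+1) : col' j v = 0 -> v = v 0 j *: delta_mx 0 j.
Proof.
move=> v0; apply/rowP=> i; rewrite !mxE eqxx /=.
case: (unliftP j i) => [k ->|->]; last by rewrite eqxx mulr1.
move/rowP/(_ k): v0; rewrite !mxE => ->.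
by rewrite eq_sym (negPf (neq_lift _ _)) mulr0.
Qed.

Lemma sub_col' (v : 'rV[F]_m.+1) : (v <= M)%MS -> (col' j v <= col' j M)%MS.
Proof. by move=> /submxP[w ->]; rewrite mul_col' submxMl. Qed.

(** A subspace containing the kernel of the projection that forgets coordinate j is the full
    preimage of its image. *)
Lemma sub_col'_delta (v : 'rV[F]_m.+1) :
  ((delta_mx 0 j : 'rV[F]_m.+1) <= M)%MS ->
  (v <= M)%MS = (col' j v <= col' j M)%MS.
Proof.
move=> sub_j; apply/idP/idP=> [|/submxP[w defv]]; first exact: sub_col'.
have /col'_eq0 eq_v : col' j (v - w *m M) = 0.
  apply/rowP=> i; have /rowP/(_ i) := defv; rewrite -mul_col' !mxE => ->.
  by rewrite subrr.
rewrite -(subrK (w *m M) v) addmx_sub ?submxMl // eq_v.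
exact: scalemx_sub.
Qed.

(** Here the row space lies in the hyperplane where coordinate j vanishes, and the projection is
    injective on that hyperplane. *)
Lemma sub_col'_zero (v : 'rV[F]_m.+1) : col j M = 0 ->
  (v <= M)%MS = (v 0 j == 0) && (col' j v <= col' j M)%MS.
Proof.
move=> Mj0; have Mw0 (w : 'rV_n) : (w *m M) 0 j = 0.
  rewrite !mxE big1 // => i _; have /colP/(_ i) := Mj0.
  by rewrite !mxE => ->; rewrite mulr0.
apply/idP/andP=> [sub_v | [/eqP vj0 /submxP[w defv]]].
  by split; [move/submxP: sub_v => [w ->]; apply/eqP | apply: sub_col'].
have /col'_eq0 : col' j (v - w *m M) = 0.
  apply/rowP=> i; have /rowP/(_ i) := defv; rewrite -mul_col' !mxE => ->.
  by rewrite subrr.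
rewrite mxE mxE vj0 Mw0 subrr scale0r => /eqP; rewrite subr_eq0 => /eqP->.
exact: submxMl.
Qed.

End DeletedColumn.

(** * Intermediate fields and subgroups of the Galois group *)

Section IntermediateFields.

Variables (K : fieldType) (L : splittingFieldType K).
Hypothesis galL : galois 1%AS {:L}%AS.
Local Notation G := (gal_of (fullv : {vspace L})).
Local Notation fields := (fset_set [set: {subfield L}]%classic).

Lemma mem_fields E : E \in fields.
Proof.
by rewrite in_fset_set; [rewrite mem_set | apply: finite_intermediate].
Qed.

(** A subgroup is recovered from its fixed field, by Artin's theorem. *)
Lemma leq_card_fields (T : finType) (H : T -> {group G}) :
  injective H -> (#|T| <= #|` fields|)%N.
Proof.
move=> H_inj; rewrite cardE -(size_map (fun t => fixedField_aspace (H t))).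
apply: uniq_leq_size => [|E _]; last exact: mem_fields.
rewrite map_inj_uniq ?enum_uniq // => t u /(congr1 val) /= eq_fix.
apply: H_inj; apply: val_inj.
by rewrite /= -(gal_fixedField (H t)) eq_fix gal_fixedField.
Qed.

(** The injection is E |-> Gal(L/E); it lands in S because E is the fixed field of H, so that
    Gal(L/E) = H. *)
Lemma card_fields_leq (X : set {subfield L}) (S : {set {set G}}) :
  (forall E, X E -> exists2 H : {group G}, (H : {set G}) \in S &
     forall x, x \in E <-> (forall g, g \in H -> g x = x)) ->
  (#|` fset_set X| <= #|S|)%N.
Proof.
move=> XS; have finX : finite_set X.
  by apply: sub_finite_set (finite_intermediate galL).
rewrite cardE -(size_map (fun E : {subfield L} => 'Gal({:L} / E)%g)).
apply: uniq_leq_size => [|_ /mapP[E XE ->]].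
  rewrite map_inj_uniq ?fset_uniq // => E1 E2 eq_gal; apply: val_inj => /=.
  have galE (E : {subfield L}) : fixedField 'Gal({:L} / E)%g = E.
    by apply/galois_fixedField; apply: galoisS galL; rewrite sub1v subvf.
  by rewrite -(galE E1) eq_gal galE.
move: XE; rewrite in_fset_set // => /set_mem/XS[H SH defE].
rewrite mem_enum; suff -> : (E : {vspace L}) = fixedField H.
  by rewrite gal_fixedField.
apply/vspaceP => x; apply/idP/fixedFieldP; rewrite ?memvf //; last by move/defE.
by move/defE.
Qed.

End IntermediateFields.

(** * The support of a sub-Hopf algebra *)

Section HopfSupport.

Variables (K : fieldType) (L : splittingFieldType K).
Local Notation G := (gal_of (fullv : {vspace L})).
Variables (N : {set {perm G}}) (W : {vspace perm_alg L}).
Hypothesis hopfW : sub_hopf N W.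

Definition in_supp (t : {perm G}) : Prop := exists2 a, a \in W & a t != 0.

Lemma in_supp_sub t : in_supp t -> t \in N.
Proof.
case: hopfW => HW _ _ _ _ [a /HW[aN _] at0].
by apply: contraNT at0 => /aN->.
Qed.

(** By invariance under G, the coefficient of a at the conjugate is h(a_t), which is non-zero since
    h is injective. *)
Lemma in_supp_conj t (h : G) : in_supp t -> in_supp (t ^ left_transl_perm h)%g.
Proof.
case: hopfW => HW _ _ _ _ [a Wa at0]; exists a => //.
have [_ /(_ h)/ffunP/(_ (t ^ left_transl_perm h)%g)] := HW a Wa.
by rewrite ffunE conjgK => <-; rewrite fmorph_eq0.
Qed.

(** The hard direction must separate the terms of the sum defining [hopf_act]; stability under
    comultiplication does this. *)
Lemma fixed_by_supp (E : {subfield L}) x : is_fixed_field W E ->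
  x \in E <-> (forall t, in_supp t -> (t^-1%g 1%g : G) x = x).
Proof.
move=> defE; rewrite defE; split=> [fix_x t [a Wa at0] | fix_x a Wa];
  last first.
  rewrite /hopf_act /pa_counit mulr_suml; apply: eq_bigr => t _.
  have [-> | at0] := eqVneq (a t) 0; first by rewrite !mul0r.
  by rewrite fix_x //; exists a.
case: hopfW => _ _ _ _ /(_ a Wa) comul_a.
(* slice maps a (x) b to a_t (b . x - eps(b) x), which vanishes on W (x) W, and
   comul a to a_t (t^-1(1)(x) - x). *)
pose slice (c : perm_alg2 L) : L :=
  \sum_s c (t, s) * ((s^-1%g 1%g : G) x - x).
have sliceD c d : slice (c + d) = slice c + slice d.
  by rewrite -big_split; apply: eq_bigr => s _; rewrite ffunE mulrDl.
have sliceZ (k : K) c : slice (k *: c) = k *: slice c.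
  by rewrite scaler_sumr; apply: eq_bigr => s _; rewrite ffunE scalerAl.
have slice0 c : c \in tensor_square W -> slice c = 0.
  rewrite /tensor_square; set X := [seq _ | _ <- _, _ <- _].
  move/(@coord_span _ _ _ (in_tuple X))->.
  elim/big_ind: _ => [|c1 c2 s1 s2|i _].
  - by rewrite /slice big1 // => s _; rewrite ffunE mul0r.
  - by rewrite sliceD s1 s2 addr0.
  rewrite sliceZ; have /allpairsP[[a1 b1] /= [_ /vbasis_mem/fix_x Wb1 ->]] :=
    mem_nth 0 (ltn_ord i).
  rewrite [slice _](_ : _ = a1 t * (hopf_act b1 x - pa_counit b1 * x)).
    by rewrite Wb1 subrr mulr0 scaler0.
  rewrite /hopf_act /pa_counit mulr_suml -sumrB mulr_sumr.
  by apply: eq_bigr => s _; rewrite ffunE /= -mulrA mulrBr.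
(* The comultiplication is supported on the diagonal, so only s = t survives. *)
have := slice0 _ comul_a; rewrite /slice (bigD1 t) //= big1 => [|s ne_st].
  rewrite addr0 ffunE eqxx => /eqP; rewrite mulf_eq0 (negPf at0) subr_eq0.
  by move/eqP.
by rewrite ffunE /= eq_sym (negPf ne_st) mul0r.
Qed.

End HopfSupport.

(** * Products in A and conjugation of circle translations *)

Section Products.

Variables (F : fieldType) (A : vectType F) (mul : {bilinear A -> A -> A}).

Lemma mem_prod_space (U W : {vspace A}) u w :
  u \in U -> w \in W -> mul u w \in prod_space mul U W.
Proof.
move=> /coord_vbasis-> /coord_vbasis->.
rewrite linear_sumlz; apply: rpred_sum => i _.
rewrite linearZl_LR linear_sumr; apply/rpredZ/rpred_sum => j _.
rewrite linearZr_LR; apply: rpredZ; apply: memv_span.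
apply/allpairsP; exists ((vbasis U)`_i, (vbasis W)`_j).
by rewrite !mem_nth ?size_tuple.
Qed.

Lemma mul_in_square x y : mul x y \in power_space mul 2.
Proof. by apply: mem_prod_space; rewrite memvf. Qed.

Lemma mul3_eq0 x y z : power_space mul 3 = 0%VS -> mul (mul x y) z = 0.
Proof.
move=> A3; apply/eqP; rewrite -memv0 -A3.
by apply: mem_prod_space; rewrite ?memvf ?mul_in_square.
Qed.

End Products.

(** If t is left circle multiplication by x, then y is the circle inverse of x. Conjugating t by the
    translation by z sends the inverse image of 0 to (y o (-z)) + z = y - yz. *)
Lemma supp_circle_closed (F : fieldType) (A : vectType F)
    (mul : {bilinear A -> A -> A}) (K : fieldType) (L : splittingFieldType K)
    (f : gal_of (fullv : {vspace L}) -> A) (W : {vspace perm_alg L}) t z :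
    associative mul -> power_space mul 3 = 0%VS ->
    bijective f -> (forall g h, f (g * h)%g = f g + f h) ->
    sub_hopf (circle_translations mul f) W -> in_supp W t ->
  let y := f (t^-1 1)%g in
  exists2 t', in_supp W t' & f (t'^-1 1)%g = y - mul y z.
Proof.
move=> mulA A3 [f' f'K fK] fM hopfW supp_t y.
have f1 : f 1%g = 0 by apply: (addrI (f 1%g)); rewrite -fM mulg1 addr0.
have fV g : f (g^-1)%g = - f g.
  by apply: (addrI (f g)); rewrite -fM mulgV f1 subrr.
have := in_supp_sub hopfW supp_t; rewrite inE => /asboolP[x tE].
have xy : x + y + mul x y = 0.
  by rewrite -[LHS]/(circle mul x y) -tE permKV f1.
set h := f' z; exists (t ^ left_transl_perm h)%g.
  exact: (in_supp_conj hopfW h supp_t).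
rewrite -conjVg conjgE !permM.
have -> : (left_transl_perm h)^-1%g 1%g = (h^-1)%g.
  by apply: (perm_inj (s := left_transl_perm h)); rewrite permKV permE mulVg.
rewrite permE fM fK.
(* The argument of [f'] is y o (-z); it is verified by applying t, where A^3 = 0 removes the triple
   product. *)
have -> : (t^-1 (h^-1))%g = f' (y - mul y z - z).
  apply: (perm_inj (s := t)); rewrite permKV; apply: (can_inj f'K).
  rewrite tE fK fV fK /circle !linearBr /= mulA.
  have -> : mul x z = - mul y z - mul (mul x y) z.
    have : mul (x + y + mul x y) z = 0 by rewrite xy linear0l.
    rewrite !linearDl => /eqP; rewrite -addrA addr_eq0 => /eqP->.
    by rewrite opprD.
  rewrite mul3_eq0 // !subr0 opprK.
  have -> : mul x y = - (x + y) by apply/eqP; rewrite -addr_eq0 addrC xy.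
  rewrite !addrA; move: (x + y) (mul y z) => b a.
  by rewrite -addrA (addrC (- b)) -[a - b]opprB addrAC subrr sub0r.
by rewrite fK subrK.
Qed.

(** * Generated subgroups and linear spans over a prime field *)

Section Spans.

Variables (p m : nat) (gT : finGroupType) (q : gT -> 'rV['F_p]_m).
Hypothesis qM : forall g h, q (g * h)%g = q g + q h.

Lemma additive1 : q 1%g = 0.
Proof. by apply: (addrI (q 1%g)); rewrite -qM mulg1 addr0. Qed.

Lemma additiveX g k : q (g ^+ k)%g = q g *+ k.
Proof.
elim: k => [|k IHk]; first by rewrite expg0 mulr0n additive1.
by rewrite expgS qM IHk mulrS.
Qed.

Definition sub_preim r (M : 'M_(r, m)) : {set gT} := [set g | (q g <= M)%MS].

Lemma group_set_sub_preim r (M : 'M_(r, m)) : group_set (sub_preim M).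
Proof.
apply/group_setP; split=> [|g h]; first by rewrite inE additive1 sub0mx.
by rewrite !inE qM; apply: addmx_sub.
Qed.
Canonical sub_preim_group r (M : 'M_(r, m)) := Group (group_set_sub_preim M).

(** Scalars in a prime field are natural multiples, so a linear combination of values of q is the
    value of q at a product of powers. *)
Lemma span_generated (Y : {set gT}) : injective q ->
  sub_preim (\sum_(g in Y) <<q g>>)%MS = <<Y>>%g.
Proof.
move=> q_inj; apply/setP=> g; apply/idP/idP => [|]; last first.
  apply/subsetP; rewrite gen_subG; apply/subsetP=> h Yh.
  by rewrite inE (sumsmx_sup h) ?genmxE.
rewrite inE => /sub_sumsmxP[u def_g].
have q1 h : {k : nat | u h *m <<q h>>%MS = q (h ^+ k)%g}.
  have /sub_rVP/sig_eqW[a ->] : (u h *m <<q h>>%MS <= q h)%MS.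
    by rewrite (submx_trans (submxMl _ _)) ?genmxE.
  by exists a; rewrite additiveX -scaler_nat natr_Zp.
rewrite (_ : g = \prod_(h in Y) h ^+ sval (q1 h))%g.
  by apply: group_prod => h Yh; apply/groupX/mem_gen.
apply: q_inj; rewrite def_g (big_morph q qM additive1).
by apply: eq_bigr => h _; case: (q1 h).
Qed.

End Spans.

Lemma fixed_generated (K : fieldType) (L : splittingFieldType K)
    (Y : {set gal_of (fullv : {vspace L})}) x :
  (forall g, g \in Y -> g x = x) -> forall g, g \in <<Y>>%g -> g x = x.
Proof.
move=> fixY; pose S := [set g : gal_of (fullv : {vspace L}) | g x == x].
have gS : group_set S.
  apply/group_setP; split=> [|g h]; rewrite !inE ?gal_id //.
  by move=> /eqP gx /eqP hx; rewrite galM ?memvf // gx hx.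
have /subsetP sub : <<Y>>%g \subset Group gS.
  by rewrite gen_subG; apply/subsetP=> g Yg; rewrite inE fixY.
by move=> g /sub; rewrite inE => /eqP.
Qed.

(** * Lower bound for the denominator, upper bound for the numerator *)

Lemma card_fields_geq (p : nat) (K : fieldType) (L : splittingFieldType K) n d e
    (q : gal_of (fullv : {vspace L}) -> 'rV['F_p]_n) :
  n = (d + e)%N -> prime p -> galois 1%AS {:L}%AS -> bijective q ->
  (forall g h, q (g * h)%g = q g + q h) ->
  (p ^ (d * e) <= #|` fset_set [set: {subfield L}]%classic|)%N.
Proof.
move=> def_n; move: q; rewrite {n}def_n => q p_pr galL [q' _ q'K] qM.
rewrite -[X in (X ^ _)%N](card_Fp p_pr) -card_mx.
pose H (M : 'M['F_p]_(d, e)) := sub_preim_group qM (row_mx 1%:M M).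
apply: (leq_card_fields galL (H := H)) => M M' /(congr1 val) /setP eqH.
apply/row_matrixP=> i.
(* Row i of [1 | M] is a combination of the rows of [1 | M'], and the identity block forces that
   combination to be row i alone. *)
have := eqH (q' (row i (row_mx 1%:M M))); rewrite !inE q'K row_sub.
move/esym/submxP=> [w]; rewrite row_row_mx mul_mx_row mulmx1.
by move=> /eq_row_mx[<- ->]; rewrite row1 -rowE.
Qed.

Lemma card_galois_corr_image_leq (p m : nat) (A : vectType 'F_p)
    (mul : {bilinear A -> A -> A}) (c : {linear A -> 'rV['F_p]_m.+1})
    (K : fieldType) (L : splittingFieldType K)
    (f : gal_of (fullv : {vspace L}) -> A) :
  associative mul -> power_space mul 3 = 0%VS ->
  bijective c ->
  (forall y z, exists a, c (mul y z) = a *: delta_mx 0 ord_max) ->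
  (forall y, (forall z, mul y z = 0) -> c y 0 ord0 = 0) ->
  galois 1%AS {:L}%AS -> bijective f ->
  (forall g h, f (g * h)%g = f g + f h) ->
  (#|` fset_set (galois_corr_image (circle_translations mul f))|
     <= 2 * #|row_spaces 'F_p m|)%N.
Proof.
move=> mulA A3 c_bij c_mul c_ann galL f_bij fM.
pose q g := c (f g).
have qM g h : q (g * h)%g = q g + q h by rewrite /q fM linearD.
have q_inj : injective q by apply: inj_comp; apply: bij_inj.
(* [S1] receives the subgroups whose image under q contains the last axis, which carries A^2; [S2]
   those whose image has zero first coordinate. *)
pose S1 := [set [set g | (col' ord_max (q g) <= D)%MS]
             | D in row_spaces 'F_p m].
pose S2 := [set [set g | (q g 0 ord0 == 0) && (col' ord0 (q g) <= D)%MS]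
             | D in row_spaces 'F_p m].
have S12 : (#|S1 :|: S2| <= 2 * #|row_spaces 'F_p m|)%N.
  rewrite (leq_trans (leq_card_setU _ _)) // mul2n -addnn.
  by apply: leq_add; apply: leq_imset_card.
apply: leq_trans S12; apply: card_fields_leq => // E [W hopfW defE].
pose Y := [set g | `[< exists2 t, in_supp W t & g = (t^-1 1)%g >]].
pose M := (\sum_(g in Y) <<q g>>)%MS.
exists (sub_preim_group qM M); last first.
  move=> x; rewrite (fixed_by_supp hopfW x defE) /= /M span_generated //.
  split=> [fix_x | fix_x t supp_t].
    apply: fixed_generated => g; rewrite inE => /asboolP[t supp_t ->].
    exact: fix_x.
  by apply/fix_x/mem_gen; rewrite inE; apply/asboolP; exists t.
have Y_closed g z : g \in Y -> exists2 g', g' \in Y & f g' = f g - mul (f g) z.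
  rewrite inE => /asboolP[t supp_t ->].
  have [t' supp_t' def_t'] :=
    supp_circle_closed z mulA A3 f_bij fM hopfW supp_t.
  by exists (t'^-1 1)%g; rewrite // inE; apply/asboolP; exists t'.
have q_sub g : g \in Y -> (q g <= M)%MS.
  by move=> Yg; rewrite (sumsmx_sup g) ?genmxE.
have [[g Yg [z yz_neq0]] | Yann] :=
  pselect (exists2 g, g \in Y & exists z, mul (f g) z != 0).
  apply/setUP; left; apply/imsetP; exists <<col' ord_max M>>%MS.
    by rewrite inE genmx_id.
  apply/setP=> h; rewrite !inE genmxE; apply: sub_col'_delta.
  (* The product (f g) z is the difference of two elements of f(Y), so the last basis vector lies in
     the row space of [M]. *)
  have [a def_yz] := c_mul (f g) z.
  have a_neq0 : a != 0.
    apply: contra_neq yz_neq0 => a0; apply: (bij_inj c_bij).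
    by rewrite def_yz a0 scale0r linear0.
  rewrite -(eqmx_scale _ a_neq0) -def_yz.
  have [g' Yg' def_g'] := Y_closed g z Yg.
  have -> : c (mul (f g) z) = q g - q g'.
    by rewrite /q def_g' linearB opprB addrC subrK.
  by rewrite addmx_sub ?eqmx_opp ?q_sub.
apply/setUP; right; apply/imsetP; exists <<col' ord0 M>>%MS.
  by rewrite inE genmx_id.
apply/setP=> h; rewrite !inE genmxE; apply: sub_col'_zero.
(* Every element of f(Y) annihilates A, so [c_ann] kills the first coordinate of each generator. *)
apply/colP=> i; rewrite !mxE.
have -> : M i ord0 = row i M 0 ord0 by rewrite mxE.
have /sub_sumsmxP[u ->] : (row i M <= M)%MS by apply: row_sub.
rewrite summxE big1 // => g Yg.
have /sub_rVP[a ->] : (u g *m <<q g>>%MS <= q g)%MS.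
  by rewrite (submx_trans (submxMl _ _)) ?genmxE.
rewrite mxE c_ann ?mulr0 // => z.
apply/eqP; apply: contra_notT Yann => yz_neq0.
by exists g => //; exists z.
Qed.

(** * Coordinates adapted to the structure matrix *)

Lemma structure_coordinates (F : fieldType) (A : vectType F)
    (mul : {bilinear A -> A -> A}) m k (s : F) :
  (0 < k)%N -> (k = 1%N -> s != 0) ->
  has_structure_matrix mul (diagDs m.+1 k s) ->
  exists c : {linear A -> 'rV[F]_m.+1},
    [/\ bijective c,
        forall y z, exists a, c (mul y z) = a *: delta_mx 0 ord_max &
        forall y, (forall z, mul y z = 0) -> c y 0 ord0 = 0].
Proof.
move=> k_gt0 s_neq0 [x [x_basis defA2 mulx]].
pose c v : 'rV[F]_m.+1 := \row_i coord x i v.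
have c_lin : linear c by move=> a u v; apply/rowP=> i; rewrite !mxE linearP.
pose cL : {linear A -> 'rV[F]_m.+1} :=
  HB.pack c (GRing.isLinear.Build _ _ _ _ c c_lin).
have x_free : free x by case/andP: x_basis => _.
have c_x (i : 'I_m.+1) : c x`_i = delta_mx 0 i.
  by apply/rowP=> j; rewrite !mxE eqxx coord_free // eq_sym.
exists cL; split=> /=.
- exists (fun v : 'rV[F]_m.+1 => \sum_i v 0 i *: x`_i) => [v | v].
    rewrite [RHS](coord_basis x_basis (memvf v)).
    by apply: eq_bigr => i _; rewrite mxE.
  rewrite [LHS](linear_sum cL) /= [RHS]row_sum_delta.
  by apply: eq_bigr => i _; rewrite [LHS](linearZ_LR cL) /= c_x.
- move=> y z; have := mul_in_square mul y z; rewrite -defA2 => /vlineP[a ->].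
  by exists a; rewrite [LHS](linearZ_LR cL) /= (c_x ord_max).
(* Since the matrix is diagonal, multiplying y by the first basis vector isolates its first
   coordinate, scaled by the first entry: 1, or s when k = 1. *)
move=> y y_ann; have := y_ann x`_(@ord0 m).
rewrite {1}(coord_basis x_basis (memvf y)) linear_sumlz (bigD1 ord0) //.
rewrite big1 => [|i /andP[_ i_neq0]]; last first.
  by rewrite linearZl_LR mulx mxE (negPf i_neq0) scale0r scaler0.
rewrite /= addr0 linearZl_LR (mulx ord0 ord0) mxE eqxx k_gt0 /= mxE => /eqP.
rewrite scalerA scaler_eq0 mulf_eq0; case/orP=> [/orP[/eqP //|]|].
  case: ifP => [/eqP k1 | _]; last by rewrite oner_eq0.
  rewrite (negPf (s_neq0 _)) //.
  by case: k k_gt0 k1 {mulx s_neq0} => // ? _ /= <-.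
move/eqP/(congr1 c); rewrite (c_x ord_max) [c _](linear0 cL).
by move/rowP/(_ ord_max)/eqP; rewrite !mxE !eqxx oner_eq0.
Qed.

(** * Comparison of the two bounds *)

Theorem proposition7p1 (n : nat) (hn : (1 < n)%N) :
  exists C : rat,
  forall (p : nat) (p_prime : prime p) (p_odd : odd p)
    (A : vectType 'F_p) (mul : {bilinear A -> A -> A})
    (mulA : associative mul) (mulC : commutative mul)
    (A_nilp : nilpotent_alg mul)
    (dimA : \dim (fullv : {vspace A}) = n)
    (A3 : power_space mul 3 = 0%VS)
    (dimA2 : \dim (power_space mul 2) = 1%N)
    (k : nat) (s : 'F_p) (hk : (1 <= k)%N)
    (rank_Phi : \rank (diagDs n k s) = k)
    (hs : s = 1 \/ (~~ odd k /\ ~ exists r : 'F_p, s = r ^+ 2))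
    (hPhi : has_structure_matrix mul (diagDs n k s))
    (K : fieldType) (L : splittingFieldType K)
    (LK_galois : galois 1%AS (fullv : {vspace L}))
    (f : gal_of (fullv : {vspace L}) -> A)
    (f_bij : bijective f)
    (f_morph : forall g h, f (g * h)%g = f g + f h),
  (odd n ->
     GC (circle_translations mul f) <= C / p%:R ^+ (n.-1)./2) /\
  (~~ odd n ->
     GC (circle_translations mul f) <= C / p%:R ^+ n./2).
Proof.
case: n hn => // m _.
(* With n = m + 1, the 2 counts the two families of subgroups and the rest is the constant of
   [card_row_spaces] in dimension m. *)
exists (2 * (m.+1 * 2 ^ m))%N%:R => p p_pr _ A mul mulA _ _ _ A3 _ k s.
move=> k_gt0 _ hs hPhi K L galL f f_bij fM.
have s_neq0 : k = 1%N -> s != 0.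
  case: hs => [-> _ | [k_even _] k1]; first exact: oner_neq0.
  by rewrite k1 in k_even.
have [c [c_bij c_mul c_ann]] := structure_coordinates k_gt0 s_neq0 hPhi.
have num_le :=
  card_galois_corr_image_leq mulA A3 c_bij c_mul c_ann galL f_bij fM.
have sp_le := card_row_spaces 'F_p m; rewrite card_Fp // in sp_le.
have def_n : m.+1 = (m.+1./2 + uphalf m.+1)%N.
  by rewrite uphalf_half addnCA addnn odd_double_half.
have den_ge : (p ^ (m.+1./2 * uphalf m.+1) <=
    #|` fset_set [set: {subfield L}]%classic|)%N.
  apply: (card_fields_geq (q := c \o f)) => // [|g h]; first exact: bij_comp.
  by rewrite /= fM linearD.
have p_gt0 := prime_gt0 p_pr.
(* Both parities have exponent floor(n/2), which is (n - 1)/2 for n odd. *)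
suff bound : GC (circle_translations mul f)
    <= (2 * (m.+1 * 2 ^ m))%N%:R / p%:R ^+ m.+1./2.
  split=> //= m_even.
  suff <- : m.+1./2 = m./2 by [].
  by rewrite -[LHS]/(uphalf m) uphalf_half (negPf m_even).
rewrite /GC; set num := #|` _|%fset in num_le *.
set den := #|` _|%fset in den_ge *.
have den_gt0 : (0 < den)%N by rewrite (leq_trans _ den_ge) // expn_gt0 p_gt0.
rewrite ler_pdivrMr ?ltr0n // mulrAC ler_pdivlMr ?exprn_gt0 ?ltr0n //.
rewrite -natrX -!natrM ler_nat.
apply: leq_trans (leq_mul num_le (leqnn _)) _.
apply: leq_trans (leq_mul (leq_mul (leqnn 2) sp_le) (leqnn _)) _.
rewrite -!mulnA -expnD !leq_mul2l /= (leq_trans _ den_ge) ?orbT //.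
(* The exponents agree: floor(n/2) = ceil(m/2) and ceil(n/2) = floor(m/2) + 1. *)
by rewrite leq_exp2l ?prime_gt1 //= mulnC -mulnSr.
Qed.
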